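(* Let $k>l\ge 1$ be integers and let $n\ge k-1$ be an integer. Then $$\binom{k-1}{l}La(n-k+1,P_3,P_2)\le La(n,D_k,D_l)\le\left(\binom{k+1}{2}-k\right)\binom{k-1}{l}La(n,P_3,P_2).$$
   Context: $[n]=\{1,\dots,n\}$, and $2^{[n]}$ is the family of all subsets of $[n]$. For a finite poset $P$ and a family $\mathcal{F}$ of sets, a subfamily $\mathcal{G}\subseteq\mathcal{F}$ is a copy of $P$ in $\mathcal{F}$ if there is a bijection $\phi:P\to\mathcal{G}$ such that $x\le_P x'$ implies $\phi(x)\subseteq\phi(x')$ (the converse implication is not required). $c(P,\mathcal{F})$ denotes the number of copies of $P$ in $\mathcal{F}$ (i.e. the number of such subfamilies $\mathcal{G}$). For posets $P,Q$, $La(n,P,Q)=\max\{c(Q,\mathcal{F}):\mathcal{F}\subseteq 2^{[n]},\ c(P,\mathcal{F})=0\}$. $P_k$ is the chain on $k$ elements. The generalized diamond $D_k$ has $k+2$ elements $a,b_1,\dots,b_k,c$ with $a<b_1,\dots,b_k<c$. *)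

(* Defs.v *)
From HB Require Import structures.
From mathcomp Require Import all_boot all_order.

Set Implicit Arguments.
Unset Strict Implicit.
Unset Printing Implicit Defensive.

(* [phi] need not reflect the order (weak, i.e. non-induced, copies). *)
Definition is_copy (d : Order.disp_t) (P : finPOrderType d) (T : finType)
    (G : {set {set T}}) : bool :=
  [exists phi : {ffun P -> {set T}},
    [&& injectiveb phi,
        [set phi x | x in P] == G
      & [forall x : P, forall y : P, (x <= y)%O ==> (phi x \subset phi y)]]].

Definition copies (d : Order.disp_t) (P : finPOrderType d) (T : finType)
    (F : {set {set T}}) : nat :=
  #|[set G : {set {set T}} | (G \subset F) && is_copy P G]|.

(* The ground set [n] is encoded as 'I_n. For nonempty P the empty family is
   admissible, so this is a maximum over a nonempty finite set. *)
Definition La (d d' : Order.disp_t) (n : nat) (P : finPOrderType d)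
    (Q : finPOrderType d') : nat :=
  \max_(F : {set {set 'I_n}} | copies P F == 0) copies Q F.

Arguments La {d d'} n P Q.

(* 'I_k carries the order induced from nat, a chain on k elements. *)
Notation chain k := 'I_k (only parsing).

Inductive diamond (k : nat) : Type :=
  | DBot
  | DMid of 'I_k
  | DTop.

Arguments DBot {k}.
Arguments DTop {k}.

Section DiamondPoset.
Variable k : nat.

Definition diamond_code (x : diamond k) : option (option 'I_k) :=
  match x with DBot => None | DTop => Some None | DMid i => Some (Some i) end.

Definition diamond_decode (x : option (option 'I_k)) : diamond k :=
  match x with None => DBot | Some None => DTop | Some (Some i) => DMid i end.

Lemma diamond_codeK : cancel diamond_code diamond_decode.
Proof. by case. Qed.

HB.instance Definition _ := Finite.copy (diamond k) (can_type diamond_codeK).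

Definition diamond_le (x y : diamond k) : bool :=
  match x, y with
  | DBot, _ => true
  | _, DTop => true
  | DMid i, DMid j => i == j
  | _, _ => false
  end.

Lemma diamond_le_refl : reflexive diamond_le.
Proof. by case=> //= i; rewrite eqxx. Qed.

Lemma diamond_le_anti : antisymmetric diamond_le.
Proof. by case=> [|i|] [|j|] //= /andP[/eqP ->]. Qed.

Lemma diamond_le_trans : transitive diamond_le.
Proof. by case=> [|i|] [|j|] [|h|] //= /eqP ->. Qed.

Fact diamond_display : Order.disp_t. Proof. exact: Order.Disp tt tt. Qed.

HB.instance Definition _ :=
  Order.Le_isPOrder.Build diamond_display (diamond k)
    diamond_le_refl diamond_le_anti diamond_le_trans.

End DiamondPoset.

(* Main.v *)
Require Import Defs.
From mathcomp Require Import all_boot all_order.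
From mathcomp Require Import zify.

(** Everything is read off the pairs [A < B] of members of a family [F] and the
    numbers of members of [F] strictly between them: the copies of [D_l] in [F]
    are counted by the sum of ['C(m(A,B), l)] over these pairs, and [P_2], [P_3]
    are [D_0], [D_1].

    Upper bound: a [D_k]-free [F] has [m(A,B) <= k-1] and no chain of [k+2]
    sets, so it splits into [k+1] antichains according to height.  A pair with
    [m(A,B) > 0] joins two nonconsecutive antichains, and the union of any two
    antichains is [P_3]-free.

    Lower bound: add a set [X] of [k-1] new points to the ground set of a
    [P_3]-free family.  Keep the minimal members [A], add all [A + x] for [x] in
    [X], and replace the other members [B] by the union of [B] and [X].  The sets
    strictly between [A] and [B + X] are then exactly the [k-1] sets [A + x]. *)

Set Implicit Arguments.
Unset Strict Implicit.
Unset Printing Implicit Defensive.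

(** * Diamonds in a family, counted by their least and greatest members *)

Section Counting.
Variable T : finType.
Implicit Types (A B C : {set T}) (F G M : {set {set T}}).

Definition between A B : {set {set T}} :=
  [set C : {set T} | (A \proper C) && (C \proper B)].

Definition proper_pairs F : {set {set T} * {set T}} :=
  [set p | [&& p.1 \in F, p.2 \in F & p.1 \proper p.2]].

(** Injectivity of [phi] turns its inclusions into proper ones. The middle elements of the diamond
    are pairwise incomparable, so any [k] sets strictly between [A] and [B] can be their images, in
    any order. *)
Lemma is_copy_diamondP k G :
  reflect (exists A B M, [/\ A \proper B, M \subset between A B, #|M| = k
                           & G = A |: (B |: M)])
          (is_copy (diamond k) G).
Proof.
apply: (iffP existsP) => [[phi]|[A [B [M [AB MAB cM ->]]]]].
  case/and3P=> /injectiveP inj /eqP <- /forallP le_phi.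
  have mono x y : (x <= y)%O -> x != y -> phi x \proper phi y.
    move=> xy neq; rewrite properEneq (inj_eq inj) neq /=.
    by move/forallP/(_ y)/implyP: (le_phi x); apply.
  exists (phi DBot), (phi DTop), [set phi (DMid i) | i : 'I_k]; split.
  - exact: mono.
  - by apply/subsetP=> _ /imsetP[i _ ->]; rewrite inE !mono.
  - by rewrite card_imset ?card_ord // => i j /inj [].
  - apply/setP=> C; rewrite !inE; apply/imsetP/or3P.
      case=> -[|i|] _ ->; [by constructor 1| |by constructor 2].
      by constructor 3; apply: imset_f.
    by case=> [/eqP->|/eqP->|/imsetP[i _ ->]]; [exists DBot|exists DTop|exists (DMid i)].
(* The default [set0] is never reached, since [M] has [k] members. *)
pose e (i : 'I_k) := nth set0 (enum M) i.
have szM : size (enum M) = k by rewrite -cardE.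
have eM i : e i \in M by rewrite -mem_enum mem_nth ?szM.
have /subsetP sM := MAB.
have Ae i : A \proper e i by move/sM: (eM i); rewrite inE => /andP[].
have eB i : e i \proper B by move/sM: (eM i); rewrite inE => /andP[].
have e_inj : injective e.
  move=> i j /eqP; rewrite nth_uniq ?szM ?enum_uniq // => /eqP.
  exact: val_inj.
exists [ffun x : diamond k => match x with DBot => A | DTop => B | DMid i => e i end].
apply/and3P; split.
- apply/injectiveP=> -[|i|] [|j|]; rewrite !ffunE // => E.
  + by move: (Ae j); rewrite -E properxx.
  + by move: AB; rewrite -E properxx.
  + by move: (Ae i); rewrite E properxx.
  + by rewrite (e_inj _ _ E).
  + by move: (eB i); rewrite E properxx.
  + by move: AB; rewrite E properxx.
  + by move: (eB j); rewrite E properxx.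
- apply/eqP/setP=> C; rewrite !inE; apply/imsetP/or3P.
    case=> -[|i|] _ ->; rewrite ffunE; [by constructor 1| |by constructor 2].
    by constructor 3.
  case=> [/eqP->|/eqP->|CM]; [by exists DBot; rewrite ?ffunE| |].
    by exists DTop; rewrite ?ffunE.
  have iC : index C (enum M) < k by rewrite -szM index_mem mem_enum.
  by exists (DMid (Ordinal iC)); rewrite // ffunE /e /= nth_index ?mem_enum.
- apply/forallP=> -[|i|]; apply/forallP=> -[|j|]; rewrite !ffunE ?subxx ?implybT //.
  + by rewrite proper_sub ?Ae ?implybT.
  + by rewrite proper_sub ?implybT.
  + by apply/implyP=> /eqP ->.
  + by rewrite proper_sub ?eB ?implybT.
Qed.

Lemma between_diamond A B M :
  A \proper B -> M \subset between A B ->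
  between A B :&: (A |: (B |: M)) = M.
Proof.
move=> AB /subsetP sM; apply/setP=> C; rewrite !inE.
case CM: (C \in M); first by move/sM: CM; rewrite inE => -> /=; rewrite !orbT.
by rewrite orbF; case: eqVneq => [->|_]; case: eqVneq => [->|_];
  rewrite ?properxx ?andbF.
Qed.

(** [A] and [B] are the least and greatest members of the copy, so the subfamily alone determines
    them, and then [M]. Hence counting copies amounts to counting triples [(A, B, M)]. *)
Lemma diamond_inj A B M A' B' M' :
    A \proper B -> M \subset between A B ->
    A' \proper B' -> M' \subset between A' B' ->
  A |: (B |: M) = A' |: (B' |: M') -> [/\ A = A', B = B' & M = M'].
Proof.
have bounds A1 B1 M1 C : A1 \proper B1 -> M1 \subset between A1 B1 ->
    C \in A1 |: (B1 |: M1) -> (A1 \subset C) && (C \subset B1).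
  move=> AB /subsetP sM; rewrite !inE => /or3P[/eqP->|/eqP->|/sM].
  - by rewrite subxx proper_sub.
  - by rewrite subxx proper_sub.
  - by rewrite inE => /andP[??]; rewrite !proper_sub.
move=> AB sM AB' sM' E.
have EA : A = A'.
  apply/eqP; rewrite eqEsubset.
  have /(bounds _ _ _ _ AB sM)/andP[-> _] : A' \in A |: (B |: M) by rewrite E !inE eqxx.
  by have /(bounds _ _ _ _ AB' sM')/andP[->] : A \in A' |: (B' |: M') by rewrite -E !inE eqxx.
have EB : B = B'.
  apply/eqP; rewrite eqEsubset andbC.
  have /(bounds _ _ _ _ AB sM)/andP[_ ->] : B' \in A |: (B |: M).
    by rewrite E !inE eqxx orbT.
  have /(bounds _ _ _ _ AB' sM')/andP[_ ->] // : B \in A' |: (B' |: M').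
  by rewrite -E !inE eqxx orbT.
split=> //; rewrite -(between_diamond AB sM) E EA EB.
by rewrite between_diamond.
Qed.

Lemma copies_diamond k F :
  copies (diamond k) F =
    \sum_(p in proper_pairs F) 'C(#|F :&: between p.1 p.2|, k).
Proof.
pose draws (p : {set T} * {set T}) :=
  [set M : {set {set T}} | (M \subset F :&: between p.1 p.2) & #|M| == k].
pose S := [set x | (x.1 \in proper_pairs F) && (x.2 \in draws x.1)].
pose build (x : {set T} * {set T} * {set {set T}}) := x.1.1 |: (x.1.2 |: x.2).
have inS A B M : ((A, B, M) \in S) =
    [&& A \in F, B \in F, A \proper B, M \subset F, M \subset between A B
      & #|M| == k].
  rewrite !inE /= subsetI.
  by case: (A \in F); case: (B \in F); case: (A \proper B); case: (M \subset F).
have build_inj : {in S &, injective build}.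
  move=> [[A B] M] [[A' B'] M']; rewrite !inS.
  case/and5P=> _ _ AB _ /andP[sM _] /and5P[_ _ AB' _ /andP[sM' _]].
  by case/(diamond_inj AB sM AB' sM') => -> -> ->.
have -> : copies (diamond k) F = #|build @: S|.
  apply: eq_card => G; rewrite inE; apply/andP/imsetP.
    case=> GF /is_copy_diamondP[A [B [M [AB sM cM EG]]]].
    exists (A, B, M) => //.
    move: GF; rewrite EG !subUset !sub1set => /and3P[AF BF MF].
    by rewrite inS AF BF AB MF sM cM eqxx.
  case=> -[[A B] M]; rewrite inS.
  case/and5P=> AF BF AB MF /andP[sM /eqP cM] ->; split.
    by rewrite !subUset !sub1set AF BF MF.
  by apply/is_copy_diamondP; exists A, B, M.
rewrite card_in_imset // -sum1_card.
rewrite (eq_bigr (fun p => \sum_(M in draws p) 1)); last first.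
  by move=> p _; rewrite sum1_card cards_draws.
by rewrite pair_big_dep /=; apply: eq_bigl => x; rewrite inE.
Qed.

Lemma copies_diamond_eq0 k F :
  (copies (diamond k) F == 0) =
    [forall p in proper_pairs F, #|F :&: between p.1 p.2| < k].
Proof.
rewrite copies_diamond sum_nat_eq0; apply: eq_forallb_in => p _.
by rewrite -leqn0 leqNgt bin_gt0 -ltnNge.
Qed.

(** Carries the diamond counts over to the chains of two and three elements. *)
Lemma copies_iso d d' (P : finPOrderType d) (Q : finPOrderType d')
    (f : P -> Q) (g : Q -> P) F :
  cancel f g -> cancel g f -> {mono f : x y / (x <= y)%O} ->
  copies P F = copies Q F.
Proof.
move=> fK gK f_mono; apply: eq_card => G; rewrite !inE; congr (_ && _).
apply/existsP/existsP=> -[phi /and3P[/injectiveP inj /eqP <- /forallP le_phi]].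
  exists [ffun y => phi (g y)]; apply/and3P; split.
  - by apply/injectiveP=> x y; rewrite !ffunE => /inj/(can_inj gK).
  - apply/eqP/setP=> C; apply/imsetP/imsetP=> -[x _ ->].
      by exists (g x); rewrite ?ffunE.
    by exists (f x); rewrite ?ffunE ?fK.
  - apply/forallP=> x; apply/forallP=> y; rewrite !ffunE.
    by rewrite -{1}(gK x) -{1}(gK y) f_mono; move/forallP: (le_phi (g x)).
exists [ffun y => phi (f y)]; apply/and3P; split.
- by apply/injectiveP=> x y; rewrite !ffunE => /inj/(can_inj fK).
- apply/eqP/setP=> C; apply/imsetP/imsetP=> -[x _ ->].
    by exists (f x); rewrite ?ffunE.
  by exists (g x); rewrite ?ffunE ?gK.
- apply/forallP=> x; apply/forallP=> y; rewrite !ffunE -f_mono.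
  by move/forallP: (le_phi (f x)).
Qed.

Lemma copies_chain2 F : copies (chain 2) F = #|proper_pairs F|.
Proof.
pose f (i : 'I_2) : diamond 0 := if i == 0 :> nat then DBot else DTop.
pose g (x : diamond 0) : 'I_2 := if x is DBot then ord0 else ord_max.
have fK : cancel f g by case=> -[|[|[]]] // i; apply: val_inj.
have gK : cancel g f by case=> [|[]|].
have f_mono : {mono f : x y / (x <= y)%O} by case=> -[|[|[]]] // ? [[|[|[]]] ?].
rewrite (copies_iso F fK gK f_mono).
by rewrite copies_diamond -sum1_card; apply: eq_bigr => p _; rewrite bin0.
Qed.

Lemma copies_chain3_eq0 F :
  reflect {in F & & , forall A B C, A \proper B -> ~~ (B \proper C)}
          (copies (chain 3) F == 0).
Proof.
pose f (i : 'I_3) : diamond 1 :=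
  match val i with 0 => DBot | 1 => DMid ord0 | _ => DTop end.
pose g (x : diamond 1) : 'I_3 :=
  match x with DBot => ord0 | DMid _ => inord 1 | DTop => ord_max end.
have fK : cancel f g by case=> -[|[|[|[]]]] // i; apply: val_inj; rewrite /= ?inordK.
have gK : cancel g f.
  by case=> [|i|] //; rewrite /f /= inordK // [i]ord1.
have f_mono : {mono f : x y / (x <= y)%O}.
  by case=> -[|[|[|[]]]] // ? [[|[|[|[]]]] ?].
rewrite (copies_iso F fK gK f_mono).
rewrite copies_diamond_eq0.
apply: (iffP forall_inP) => [noF A B C AF BF CF AB|noF [A C]].
  apply/negP=> BC; have /noF : (A, C) \in proper_pairs F.
    by rewrite inE /= AF CF (proper_trans AB BC).
  by rewrite ltnS leqn0 cards_eq0 => /eqP/setP/(_ B); rewrite !inE /= BF AB BC.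
rewrite inE /= => /and3P[AF CF _]; rewrite ltnS leqn0 cards_eq0 -subset0.
apply/subsetP=> B; rewrite !inE => /and3P[BF AB].
by rewrite (negPf (noF _ _ _ AF BF CF AB)).
Qed.

End Counting.

Lemma leq_La d d' (P : finPOrderType d) (Q : finPOrderType d') n
    (F : {set {set 'I_n}}) :
  copies P F == 0 -> copies Q F <= La n P Q.
Proof. exact: leq_bigmax_cond. Qed.

(** * Levels of a family *)

Section Height.
Variables (T : finType) (F : {set {set T}}).
Implicit Types (A B : {set T}) (G : {set {set T}}).

Definition chain_below B G :=
  (G \subset [set A in F | A \proper B]) &&
  [forall A1 in G, forall A2 in G, (A1 \subset A2) || (A2 \subset A1)].

(** [B] itself is left out of the chain, so minimal members of [F] have height 0, and heights 0 to
    [k] make [k + 1] levels. *)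
Definition height B := \max_(G | chain_below B G) #|G|.

Lemma height_attained B : exists2 G, chain_below B G & height B = #|G|.
Proof.
have : 0 < #|[pred G | chain_below B G]|.
  apply/card_gt0P; exists set0; rewrite inE /chain_below sub0set /=.
  by apply/forall_inP=> A; rewrite inE.
by case/(eq_bigmax_cond (fun G => #|G|)) => G ? ?; exists G.
Qed.

(** A longest chain below [A], extended by [A], is a chain below [B]. *)
Lemma height_lt A B : A \in F -> A \proper B -> height A < height B.
Proof.
move=> AF AB; have [G /andP[/subsetP sG /forall_inP tot] ->] := height_attained A.
have AG : A \notin G by apply/negP=> /sG; rewrite inE properxx andbF.
rewrite (_ : _.+1 = #|A |: G|); last by rewrite cardsU1 AG.
apply: leq_bigmax_cond.
have GA C : C \in G -> C \subset A by move/sG; rewrite inE => /andP[_ /proper_sub].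
apply/andP; split.
  apply/subsetP=> C; rewrite !inE => /orP[/eqP->|/sG]; first by rewrite AF.
  by rewrite inE => /andP[-> /proper_trans->].
apply/forall_inP=> C1 C1G; apply/forall_inP=> C2 C2G; move: C1G C2G.
rewrite !inE => /orP[/eqP->|C1G] /orP[/eqP->|C2G]; rewrite ?subxx ?GA ?orbT //.
by have /forall_inP := tot _ C1G; apply.
Qed.

(** Let [A] be the smallest set of a longest chain below [B]. The other sets of the chain lie
    strictly between [A] and [B], so there are fewer than [k] of them. *)
Lemma height_le k B :
  {in proper_pairs F, forall p, #|F :&: between p.1 p.2| < k} ->
  B \in F -> height B <= k.
Proof.
move=> midF BF; have [G /andP[/subsetP sG /forall_inP tot] ->] := height_attained B.
have [->|[A0 A0G]] := set_0Vmem G; first by rewrite cards0.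
case: (arg_minnP (fun A : {set T} => #|A|) A0G) => A /= AG minA; change (A \in G : Prop) in AG.
have /andP[AF AB] : (A \in F) && (A \proper B) by move/sG: AG; rewrite inE.
have : #|F :&: between A B| < k by apply: (midF (A, B)); rewrite inE /= AF BF AB.
rewrite (cardsD1 A G) AG; apply: leq_ltn_trans; apply: subset_leq_card.
apply/subsetP=> C; rewrite !inE => /andP[CA CG].
move/sG: (CG); rewrite inE => /andP[-> ->]; rewrite andbT /=.
rewrite properEneq eq_sym CA /=.
have /forall_inP/(_ C CG)/orP[//|sCA] := tot _ AG.
by move: CA; rewrite eqEcard sCA minA.
Qed.

End Height.

(** * The upper bound *)

Lemma card_gap_pairs k :
  \sum_(q : 'I_k.+1 * 'I_k.+1 | q.1.+1 < q.2) 1 = 'C(k, 2).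
Proof.
rewrite -(pair_big_dep xpredT (fun i j : 'I_k.+1 => i.+1 < j) (fun _ _ => 1)) /=.
(* The larger index 0 contributes nothing; after the shift, the larger index [j + 1] admits exactly
   the [j] values [i < j]. *)
rewrite (exchange_big_dep xpredT) //= -bin2_sum big_ord_recl /= big_mkord.
rewrite big_pred0 // add0n; apply: eq_bigr => j _.
rewrite sum1_card.
have jk : j <= k.+1 by rewrite ltnW // ltnS ltnW.
have widen_inj : injective (widen_ord jk) by move=> x y [/val_inj].
rewrite -[RHS]card_ord -(card_imset _ widen_inj).
apply: eq_card => i; rewrite unfold_in -[LHS]/(i < j).
apply/idP/imsetP=> [ij|[x _ ->]]; last exact: (ltn_ord x).
by exists (Ordinal ij) => //; apply: val_inj.
Qed.

Lemma La_diamond_upper k l n : 1 <= l -> l < k ->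
  La n (diamond k) (diamond l) <= 'C(k, 2) * 'C(k - 1, l) * La n (chain 3) (chain 2).
Proof.
move=> l1 lk; apply/bigmax_leqP=> F; rewrite copies_diamond_eq0 => /forall_inP midF.
pose h := height F.
pose S := [set p in proper_pairs F | F :&: between p.1 p.2 != set0].
(* A member strictly between the two has a height strictly between theirs. *)
have hS p : p \in S -> [/\ p.1 \in F, p.2 \in F, p.1 \proper p.2 & (h p.1).+1 < h p.2].
  case: p => A B; rewrite inE => /andP[]; rewrite inE /= => /and3P[AF BF AB].
  case/set0Pn=> C; rewrite !inE => /and3P[CF AC CB]; split=> //.
  exact: leq_ltn_trans (height_lt AF AC) (height_lt CF CB).
have -> : 'C(k, 2) * 'C(k - 1, l) * La n (chain 3) (chain 2)
         = 'C(k, 2) * La n (chain 3) (chain 2) * 'C(k - 1, l) by rewrite mulnAC.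
(* Pairs outside [S] contribute ['C(0, l) = 0] since [1 <= l], and each pair in [S] at most
   ['C(k - 1, l)]. It remains to bound [#|S|]. *)
apply: (@leq_trans (#|S| * 'C(k - 1, l))).
  rewrite copies_diamond (bigID (fun p => F :&: between p.1 p.2 != set0)) /=.
  rewrite [X in _ + X]big1 ?addn0 => [|p /andP[_ /negPn/eqP->]]; last first.
    by rewrite cards0 bin_small.
  rewrite -sum_nat_const [X in _ <= X](eq_bigl _ _ (in_set _)).
  apply: leq_sum => p /andP[pF _]; apply: leq_bin2l.
  by rewrite subn1 -ltnS (ltn_predK lk) midF.
rewrite leq_mul2r; apply/orP; right.
(* [S] is partitioned by the heights of both ends; [inord] keeps them intact because members have
   height at most [k]. *)
pose col (p : {set 'I_n} * {set 'I_n}) : 'I_k.+1 * 'I_k.+1 :=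
  (inord (h p.1), inord (h p.2)).
have hk A : A \in F -> h A < k.+1 by rewrite ltnS; apply: height_le.
rewrite -card_gap_pairs -sum1_card big_distrl /=.
rewrite (partition_big col (fun q => q.1.+1 < q.2)) => [|p /hS[AF BF _ hp]]; last first.
  by rewrite /= !inordK ?hk.
apply: leq_sum => -[i j] /= ij; rewrite mul1n sum1_card.
pose Fij := [set A in F | (h A == i) || (h A == j)].
apply: (@leq_trans (copies (chain 2) Fij)); last first.
  (* Heights increase strictly along three nested members, but only the two values [i] and [j] are
     available. *)
  apply: leq_La; apply/copies_chain3_eq0 => A B C.
  rewrite !inE => /andP[AF hA] /andP[BF hB] /andP[CF hC] AB; apply/negP=> BC.
  move: (height_lt AF AB) (height_lt BF BC) hA hB hC; rewrite -/h; lia.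
rewrite copies_chain2; apply: subset_leq_card; apply/subsetP=> p.
rewrite !inE => /andP[pS /eqP[Ei Ej]]; have [AF BF AB _] := hS p pS.
have hi : h p.1 = i by rewrite -Ei inordK ?hk.
have hj : h p.2 = j by rewrite -Ej inordK ?hk.
by rewrite AF BF AB hi hj !eqxx orbT.
Qed.

(** * The lower bound: adding [q] new points to the ground set *)

Section DisjointUnion.
Variables m q : nat.
Implicit Types (A B C : {set 'I_m}) (Y : {set 'I_q}) (Z : {set 'I_(m + q)}).

Definition lpart Z : {set 'I_m} := lshift q @^-1: Z.
Definition rpart Z : {set 'I_q} := @rshift m q @^-1: Z.
Definition glue A Y : {set 'I_(m + q)} :=
  [set i | match split i with inl a => a \in A | inr y => y \in Y end].

Lemma lpart_glue A Y : lpart (glue A Y) = A.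
Proof. by apply/setP=> i; rewrite !inE (unsplitK (inl i)). Qed.

Lemma rpart_glue A Y : rpart (glue A Y) = Y.
Proof. by apply/setP=> i; rewrite !inE (unsplitK (inr i)). Qed.

Lemma glue_parts Z : glue (lpart Z) (rpart Z) = Z.
Proof. by apply/setP=> i; rewrite inE; case: split_ordP => j ->; rewrite inE. Qed.

Lemma subset_parts Z Z' :
  (Z \subset Z') = (lpart Z \subset lpart Z') && (rpart Z \subset rpart Z').
Proof.
apply/idP/andP=> [sZ|[sl sr]]; first by rewrite !preimsetS.
apply/subsetP=> i; case: (split_ordP i) => j -> iZ.
  by have /(subsetP sl) : j \in lpart Z; rewrite inE.
by have /(subsetP sr) : j \in rpart Z; rewrite inE.
Qed.

Lemma glue_inj A Y A' Y' : glue A Y = glue A' Y' -> A = A' /\ Y = Y'.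
Proof.
move=> E; move: (congr1 lpart E) (congr1 rpart E).
by rewrite !lpart_glue !rpart_glue.
Qed.

Lemma proper_parts Z Z' :
  (Z \proper Z') = [&& lpart Z \subset lpart Z', rpart Z \subset rpart Z'
                     & (lpart Z != lpart Z') || (rpart Z != rpart Z')].
Proof.
rewrite properEneq andbC subset_parts -andbA; congr [&& _, _ & _].
rewrite -negb_and; congr (~~ _); apply/eqP/andP=> [->|[/eqP El /eqP Er]] //.
by rewrite -(glue_parts Z) El Er glue_parts.
Qed.

Variable F : {set {set 'I_m}}.

Definition is_min A := [forall A' in F, ~~ (A' \proper A)].

(** The bound [#|rpart Z| <= 1] admits both a minimal [A] itself and every [A + x]. A member that is
    minimal and maximal at once is treated as minimal. *)
Definition blowup : {set {set 'I_(m + q)}} :=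
  [set Z | (lpart Z \in F) &&
    (if is_min (lpart Z) then #|rpart Z| <= 1 else rpart Z == setT)].

Lemma glue_blowup A Y :
  (glue A Y \in blowup) =
    (A \in F) && (if is_min A then #|Y| <= 1 else Y == setT).
Proof. by rewrite inE lpart_glue rpart_glue. Qed.

Hypothesis F3 : {in F & & , forall A B C, A \proper B -> ~~ (B \proper C)}.

(** Let [Z] lie strictly between. If its old part is minimal, [Z1] has the same old part, so [Z] has
    strictly more new points than [Z1], hence exactly one: [q] choices. Otherwise [Z] contains all
    new points and, as [F] has no chain of three, has the old part of [Z2]; then [Z = Z2], a
    contradiction. *)
Lemma blowup_between Z1 Z2 : Z1 \in blowup -> Z2 \in blowup ->
  #|blowup :&: between Z1 Z2| <= q.
Proof.
move=> Z1F Z2F; rewrite -[q in _ <= q]card_ord.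
apply: leq_trans (leq_imset_card (fun x => glue (lpart Z1) [set x]) 'I_q).
apply: subset_leq_card; apply/subsetP=> Z.
rewrite in_setI [Z \in between _ _]inE !proper_parts.
move: Z1F Z2F; rewrite !inE -[Z in Z \in imset _ _]glue_parts.
move: (lpart Z1) (rpart Z1) (lpart Z2) (rpart Z2) (lpart Z) (rpart Z).
move=> A1 Y1 A2 Y2 A Y /andP[A1F cY1] /andP[A2F cY2].
case/and3P=> /andP[AF cY] /and3P[sA1 sY1 ne1] /and3P[sA2 sY2 ne2].
case: ifP cY => [/forall_inP minA | /negbT].
  have eA1 : A1 = A.
    by apply/eqP; move: (minA _ A1F); rewrite properEneq sA1 andbT negbK.
  rewrite eA1 eqxx /= in ne1 *; move=> cY.
  have ltY : #|Y1| < #|Y| by apply: proper_card; rewrite properEneq ne1.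
  have /cards1P[x ->] : #|Y| == 1 by rewrite eqn_leq cY (leq_ltn_trans _ ltY).
  exact: imset_f.
rewrite negb_forall_in => /exists_inP[B BF]; rewrite negbK => BA /eqP EY.
move: (F3 BF AF A2F BA); rewrite properEneq sA2 andbT negbK => /eqP EA2.
move: ne2; rewrite EA2 eqxx /= EY.
by move: sY2; rewrite EY subTset eq_sym => ->.
Qed.

(** A pair [A < B] of [F] yields the pair of [A] and [B + X], with all [q] sets [A + x] strictly
    between. Distinct pairs yield distinct pairs, and these alone supply the claimed number of
    copies. *)
Lemma blowup_copies k l : q < k ->
  copies (diamond k) blowup = 0 /\
  'C(q, l) * #|proper_pairs F| <= copies (diamond l) blowup.
Proof.
move=> qk; split.
  apply/eqP; rewrite copies_diamond_eq0; apply/forall_inP=> p.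
  rewrite inE => /and3P[p1 p2 _].
  exact: leq_ltn_trans (blowup_between p1 p2) qk.
pose f (p : {set 'I_m} * {set 'I_m}) := (glue p.1 set0, glue p.2 setT).
have f_inj : injective f.
  by move=> [A B] [A' B'] [/glue_inj[-> _] /glue_inj[-> _]].
rewrite mulnC -sum_nat_const copies_diamond.
(* A member below another has none below itself, or [F] would contain a chain of three. *)
have min1 A B : A \in F -> B \in F -> A \proper B -> is_min A.
  by move=> AF BF AB; apply/forall_inP=> C CF; apply/negP=> /(F3 CF AF BF); rewrite AB.
have sub : f @: proper_pairs F \subset proper_pairs blowup.
  apply/subsetP=> _ /imsetP[[A B] + ->]; rewrite inE /= => /and3P[AF BF AB].
  rewrite inE /= !glue_blowup AF BF (min1 A B) //=.
  rewrite cards0 /= proper_parts !lpart_glue !rpart_glue sub0set proper_sub // (proper_neq AB) /= andbT.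
  by case: ifP => // /forall_inP/(_ A AF); rewrite AB.
rewrite [X in _ <= X](big_setID (f @: proper_pairs F)) /= (setIidPr sub).
apply: leq_trans (leq_addr _ _); rewrite big_imset /=; last by move=> ? ? _ _; apply: f_inj.
apply: leq_sum => -[A B]; rewrite inE /= => /and3P[AF BF AB]; apply: leq_bin2l.
have g_inj : injective (fun x : 'I_q => glue A [set x]).
  by move=> x y /glue_inj[_ /set1_inj].
rewrite -[q in q <= _]card_ord -(card_imset _ g_inj); apply: subset_leq_card.
apply/subsetP=> _ /imsetP[x _ ->]; rewrite in_setI glue_blowup inE !proper_parts !lpart_glue !rpart_glue.
rewrite AF (min1 A B) // cards1 !subxx sub0set subsetT (proper_sub AB).
by rewrite (proper_neq AB) eqxx /= eq_sym -cards_eq0 cards1.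
Qed.

End DisjointUnion.

Lemma La_diamond_lower k l m q : l <= q -> q < k ->
  'C(q, l) * La m (chain 3) (chain 2) <= La (m + q) (diamond k) (diamond l).
Proof.
move=> lq qk; rewrite mulnC -leq_divRL ?bin_gt0 //.
apply/bigmax_leqP=> F /copies_chain3_eq0 F3.
rewrite leq_divRL ?bin_gt0 // mulnC copies_chain2.
have [/eqP D0] := blowup_copies F3 l qk.
by move/leq_trans; apply; apply: leq_La.
Qed.

Theorem theorem1p6 (k l n : nat) (hl : 1 <= l) (hlk : l < k) (hn : k - 1 <= n) :
  'C(k - 1, l) * La (n - (k - 1)) (chain 3) (chain 2)
    <= La n (diamond k) (diamond l)
  /\ La n (diamond k) (diamond l)
    <= ('C(k + 1, 2) - k) * 'C(k - 1, l) * La n (chain 3) (chain 2).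
Proof.
split.
  (* Here [q = k - 1] points are added to [n - (k - 1)] old ones. *)
  by rewrite -[X in _ <= La X _ _](subnK hn); apply: La_diamond_lower; lia.
(* Of the ['C(k + 1, 2)] pairs of levels, the [k] consecutive ones are discarded. *)
have -> : 'C(k + 1, 2) - k = 'C(k, 2) by rewrite addn1 binS bin1 addnK.
exact: La_diamond_upper.
Qed.
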